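(* For all $n\ge 4$, $\det(AQ_n)\le 3$.
   Context: The augmented hypercube $AQ_n$ has vertex set $\mathbb{Z}_2^n$; two vertices are adjacent iff either they differ in exactly one position, or for some $0\le \ell\le n-2$ they agree in the first $\ell$ positions and differ in all of the remaining $n-\ell$ positions. A determining set of a graph is a vertex set such that the only automorphism fixing each of its vertices is the identity; $\det$ is the minimum size of a determining set. *)

(* Defs.v *)
From mathcomp Require Import all_boot all_order all_algebra all_fingroup.

Set Implicit Arguments.
Unset Strict Implicit.
Unset Printing Implicit Defensive.

(* A finite simple graph is a symmetric irreflexive adjacency relation on a
   finType of vertices. *)
Section DeterminingSets.
Variables (T : finType) (adj : rel T).

Definition graph_aut (s : {perm T}) : bool :=
  [forall x, forall y, adj (s x) (s y) == adj x y].

Definition determining (S : {set T}) : bool :=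
  [forall s : {perm T},
     graph_aut s ==> [forall x in S, s x == x] ==> (s == 1%g)].

Lemma determiningT : determining [set: T].
Proof.
apply/forallP => s; apply/implyP => _; apply/implyP => /forallP sT.
by apply/eqP/permP => x; rewrite perm1; apply/eqP; move: (sT x); rewrite inE.
Qed.

Definition det_number : nat :=
  #|[arg min_(S < [set: T] | determining S) #|S| ]|.

Lemma det_numberP :
  (exists2 S, determining S & #|S| = det_number) /\
  (forall S, determining S -> det_number <= #|S|).
Proof.
rewrite /det_number; case: arg_minnP => [|S dS minS]; first exact: determiningT.
by split; first exists S.
Qed.

End DeterminingSets.

(* Positions are numbered from 0, so "the first l positions" are the i < l;
   l : 'I_n.-1 ranges over 0 <= l <= n - 2. *)
Definition AQ (n : nat) : rel 'rV['Z_2]_n := fun u v =>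
  (#|[set i | u ord0 i != v ord0 i]| == 1)
  || [exists l : 'I_n.-1, forall i : 'I_n,
        if i < l then u ord0 i == v ord0 i else u ord0 i != v ord0 i].

Lemma AQ_sym n : symmetric (@AQ n).
Proof.
move=> u v; rewrite /AQ; congr (_ || _).
  by congr (_ == 1); apply: eq_card => i; rewrite !inE eq_sym.
apply: eq_existsb => l; apply: eq_forallb => i.
by rewrite eq_sym.
Qed.

Lemma AQ_irr n : irreflexive (@AQ n).
Proof.
move=> u; apply/negP => /orP[|/existsP[l /forallP lP]].
  by rewrite (eq_card (B := pred0)) ?card0 // => i; rewrite !inE eqxx.
have ln : l < n by apply: leq_trans (ltn_ord l) (leq_pred n).
by have := lP (Ordinal ln); rewrite /= ltnn eqxx.
Qed.

(* Main.v *)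
(**
  [AQ_n] is a Cayley graph of Z_2^n.  Summing suffix vectors identifies Z_2^n with
  the even subsets of the points 0, ..., n so that the generators become the
  pairs {a, b} with 0 < |a - b| <= 2, the edges of the square of a path; two
  generators are adjacent iff they lie in a common triangle {m, m+1, m+2}.
  The neighbourhood of any vertex y is thus a chain of triangles, and an
  automorphism fixing y, y + {0, 1} and y + {n-1, n} fixes it pointwise.
  If x and all its neighbours are fixed, then so are x + {p, q} + {0, 1} and, by
  reversing the path, x + {p, q} + {n-1, n}, hence all neighbours of x + {p, q}.
  By connectedness the vertices 0, {0, 1}, {n-1, n} form a determining set.
*)
Require Import Defs.
From mathcomp Require Import all_boot all_order all_algebra all_fingroup.
From mathcomp Require Import zify ring.

Set Implicit Arguments.
Unset Strict Implicit.
Unset Printing Implicit Defensive.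

Import GRing.Theory.
Local Open Scope ring_scope.

(** * Characteristic two *)

Lemma Z2_char2 : 2%:R = 0 :> 'Z_2.
Proof. exact/val_inj. Qed.

Lemma Z2_char4 : 4%:R = 0 :> 'Z_2.
Proof. exact/val_inj. Qed.

Lemma Z2_eq (a b : 'Z_2) : a + b = 0 -> a = b.
Proof.
move=> ab; apply/eqP; rewrite -subr_eq0 -ab; apply/eqP/(addrI b).
by ring: Z2_char2.
Qed.

(* Under the side equation [k = 0] [ring] only cancels the coefficients equal to
   [k], whence [Z2_char4] and the passage to the sum of both sides. *)
Ltac row_char2 :=
  apply/rowP => ?; rewrite !mxE; apply: Z2_eq; ring: Z2_char2 Z2_char4.

(** * Edges of the square of a path *)

Definition edge (n a b : nat) : bool := [&& a < b, b <= a.+2 & b <= n]%N.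

(** A point lying in exactly one of {a, b}, {c, d} must be p or q, so these pairs share a point and
    form a triangle with {p, q}. *)
Lemma edge_sum_edge (n a b c d p q : nat) :
    edge n a b -> edge n c d -> edge n p q ->
    (forall z, z <= n -> (z == c) (+) (z == d) =
       (z == a) (+) (z == b) (+) ((z == p) (+) (z == q)))%N ->
  (maxn b d <= (minn a c).+2)%N && ((a != c) || (b != d)).
Proof.
move=> /and3P[ab ba bn] /and3P[cd dc dn] /and3P[pq qp qn] h.
have an := leq_trans (ltnW ab) bn; have cn := leq_trans (ltnW cd) dn.
have pn := leq_trans (ltnW pq) qn.
have pqP z : (z <= n)%N -> (z == c) (+) (z == d) (+) ((z == a) (+) (z == b)) ->
    z = p \/ z = q.
  move=> /h->; rewrite addbAC addbb /=.
  by case: eqP => [->|_]; [left|case: eqP => [->|//]; right].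
have ha : a != c -> a != d -> a = p \/ a = q.
  by move=> /negPf ac /negPf ad; apply: pqP; rewrite // ac ad eqxx (ltn_eqF ab).
have hb : b != c -> b != d -> b = p \/ b = q.
  by move=> /negPf bc /negPf bd; apply: pqP; rewrite // bc bd eqxx (gtn_eqF ab).
have hc : c != a -> c != b -> c = p \/ c = q.
  by move=> /negPf ca /negPf cb; apply: pqP; rewrite // ca cb eqxx (ltn_eqF cd).
have hd : d != a -> d != b -> d = p \/ d = q.
  by move=> /negPf da /negPf db; apply: pqP; rewrite // da db eqxx (gtn_eqF cd).
have hne : (a != c) || (b != d).
  rewrite -negb_and; apply/negP => /andP[/eqP ac /eqP bd].
  have := h p pn; rewrite -ac -bd eqxx (ltn_eqF pq) /=.
  by case: (_ (+) _).
by clear h pqP; rewrite hne andbT; lia.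
Qed.

(* [g a + g b] plays the role of the pair {a, b}, and [d z] of membership of the
   point [z]. *)
Record path_frame (n : nat) (g : nat -> 'rV['Z_2]_n)
    (d : nat -> 'rV['Z_2]_n -> bool) : Prop := PathFrame {
  frameD : forall z u v, d z (u + v) = d z u (+) d z v;
  frame_pair : forall a b z, (a <= n -> b <= n -> z <= n ->
    d z (g a + g b)%R = (z == a) (+) (z == b))%N;
  frame_adj : forall u v, AQ u v <->
    exists a b, edge n a b /\ v = u + (g a + g b)
}.

(** * Automorphisms in path coordinates *)

Section Frame.
Variables (n : nat) (g : nat -> 'rV['Z_2]_n) (d : nat -> 'rV['Z_2]_n -> bool).
Hypothesis F : path_frame g d.
Local Notation w a b := (g a + g b).

Lemma adj_edge u a b : edge n a b -> AQ u (u + w a b).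
Proof. by move=> ab; apply/(frame_adj F); exists a, b. Qed.

Lemma frame_edge a b z : edge n a b -> (z <= n)%N ->
  d z (w a b) = (z == a) (+) (z == b).
Proof. by case/and3P => ab _ bn zn; apply: (frame_pair F) => //; lia. Qed.

(** For the converse, two distinct pairs among three consecutive points share one point; the other
    two points form the connecting edge. *)
Lemma adj_edges u a b c e : edge n a b -> edge n c e ->
  AQ (u + w a b) (u + w c e) =
    (maxn b e <= (minn a c).+2)%N && ((a != c) || (b != e)).
Proof.
move=> ab ce; apply/idP/idP.
  move=> /(frame_adj F)[p [q [pq E]]]; apply: (edge_sum_edge ab ce pq) => z zn.
  have {}E : w c e = w a b + w p q by apply: (addrI u); rewrite E -[LHS]addrA.
  by rewrite -!frame_edge // E (frameD F).
move: ab ce; rewrite /edge => ab ce h.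
apply/(frame_adj F).
have [ac|/eqP ac] := eqVneq a c.
  subst c; exists (minn b e), (maxn b e); split; first by move: h; rewrite /edge eqxx; lia.
  have [_|_] := leqP b e; row_char2.
have [be|/eqP be] := eqVneq b e.
  subst e; exists (minn a c), (maxn a c); split; first by rewrite /edge; lia.
  have [_|_] := leqP a c; row_char2.
have [bc|/eqP bc] := eqVneq b c.
  subst c; exists a, e; split; first by rewrite /edge; lia.
  row_char2.
have ea : e = a by lia.
subst e; exists c, b; split; first by rewrite /edge; lia.
row_char2.
Qed.

Lemma adj_pair u a b : (a < b <= n)%N -> AQ u (u + w a b) = (b <= a.+2)%N.
Proof.
move=> /andP[ab bn]; apply/idP/idP; last by move=> ?; apply: adj_edge; apply/and3P.
move=> /(frame_adj F)[p [q [pq /addrI E]]].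
have [pa qb] : p = a /\ q = b; last by move: pq => /and3P[]; lia.
have h z (zn : (z <= n)%N) : (z == a) (+) (z == b) = (z == p) (+) (z == q).
  by rewrite -(frame_edge pq) // -E (frame_pair F) //; lia.
case/and3P: pq => pq _ qn.
have := h a; have := h b.
rewrite !eqxx (ltn_eqF ab) (gtn_eqF ab) /= => /(_ ltac:(lia)) hb /(_ ltac:(lia)) ha.
move: hb ha; case: (eqVneq b q) => [?|_]; case: (eqVneq b p) => [?|_] //=;
case: (eqVneq a q) => [?|_]; case: (eqVneq a p) => [?|_] //= _ _; lia.
Qed.

Variable s : {perm 'rV['Z_2]_n}.
Hypothesis s_aut : forall u v, AQ (s u) (s v) = AQ u v.

Lemma fixed_of_fixed_image v : s (s v) = s v -> s v = v.
Proof. exact: perm_inj. Qed.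

Lemma image_edge y a b : s y = y -> edge n a b ->
  exists c e, edge n c e /\ s (y + w a b) = y + w c e.
Proof. by move=> sy ab; apply/(frame_adj F); rewrite -[X in AQ X]sy s_aut adj_edge. Qed.

(** The image is a neighbour of the fixed vertex for {i, i+1}; all candidates but {i, i+2} itself
    are already fixed. *)
Lemma fixed_nbrs_step y i : (i.+2 <= n)%N -> s y = y ->
    (forall a b, edge n a b -> (b <= i.+1)%N -> s (y + w a b) = y + w a b) ->
    s (y + w i.+1 i.+2) = y + w i.+1 i.+2 ->
  s (y + w i i.+2) = y + w i i.+2.
Proof.
move=> lin sy prev si.
have ei : edge n i i.+1 by rewrite /edge; lia.
have ei1 : edge n i.+1 i.+2 by rewrite /edge; lia.
have ee : edge n i i.+2 by rewrite /edge; lia.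
have [c [e [ce E]]] := image_edge sy ee.
have : AQ (y + w i i.+1) (y + w c e).
  by rewrite -E -(prev _ _ ei) // s_aut adj_edges //; lia.
rewrite adj_edges // => h.
have [ei1P|ei1P] := boolP ((c == i.+1) && (e == i.+2)).
  by apply: fixed_of_fixed_image; rewrite E; case/andP: ei1P => /eqP-> /eqP->.
have [eeP|eeP] := boolP ((c == i) && (e == i.+2)).
  by rewrite E; case/andP: eeP => /eqP-> /eqP->.
apply: fixed_of_fixed_image; rewrite E; apply: prev => //.
by move: ce h ei1P eeP; rewrite /edge; lia.
Qed.

Lemma fixed_nbrs y : (1 < n)%N -> s y = y ->
    s (y + w 0 1) = y + w 0 1 -> s (y + w n.-1 n) = y + w n.-1 n ->
  forall a b, edge n a b -> s (y + w a b) = y + w a b.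
Proof.
move=> n1 sy s0 sn.
have H i : (i.+2 <= n)%N -> forall a b, edge n a b -> (b <= i.+1)%N ->
    s (y + w a b) = y + w a b.
  elim: i => [|i IHi] lin a b ab bi.
    have [-> ->] : a = 0%N /\ b = 1%N by move: ab; rewrite /edge; lia.
    exact: s0.
  have {}IHi := IHi (ltnW lin).
  have ei : edge n i i.+1 by rewrite /edge; lia.
  have ei1 : edge n i.+1 i.+2 by rewrite /edge; lia.
  have ei2 : edge n i.+2 i.+3 by rewrite /edge; lia.
  have ee : edge n i i.+2 by rewrite /edge; lia.
  (* The new triangle could only have {i+1, i+2} and {i, i+2} swapped; the edge {i+2, i+3} of the
     following triangle tells them apart. *)
  have si1 : s (y + w i.+1 i.+2) = y + w i.+1 i.+2.
    have [c [e [ce E]]] := image_edge sy ei1.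
    have : AQ (y + w i i.+1) (y + w c e).
      by rewrite -E -(IHi _ _ ei) // s_aut adj_edges //; lia.
    rewrite adj_edges // => h.
    have [ei1P|ei1P] := boolP ((c == i.+1) && (e == i.+2)).
      by rewrite E; case/andP: ei1P => /eqP-> /eqP->.
    have [eeP|eeP] := boolP ((c == i) && (e == i.+2)); last first.
      apply: fixed_of_fixed_image; rewrite E; apply: IHi => //.
      by move: ce h ei1P eeP; rewrite /edge; lia.
    (* Otherwise [w i.+2 i.+3] would have to go to a neighbour of [w i i.+2],
       but these are [w i i.+1] and [w i.+1 i.+2] only. *)
    case/andP: eeP => /eqP ci /eqP ei2'; subst c e.
    have [p [q [pq E']]] := image_edge sy ei2.
    have : AQ (y + w i i.+2) (y + w p q).
      by rewrite -E -E' s_aut adj_edges //; lia.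
    have : AQ (y + w i i.+1) (y + w p q) = false.
      by rewrite -E' -(IHi _ _ ei) // s_aut adj_edges //; lia.
    rewrite !adj_edges // => h1 h2.
    have [pi qi] : p = i /\ q = i.+1 by move: pq h1 h2; rewrite /edge; lia.
    subst p q; move: E'; rewrite -(IHi _ _ ei) // => /perm_inj E'.
    have := adj_edges y ei ei1; have := adj_edges y ei2 ei1.
    have := adj_edges y ei ee; have := adj_edges y ei2 ee.
    by rewrite E' => -> /esym; lia.
  have [bi1|bi1] := leqP b i.+1; first exact: IHi.
  have -> : b = i.+2 by lia.
  have [->|->] : a = i \/ a = i.+1 by move: ab; rewrite /edge; lia.
    by apply: fixed_nbrs_step => //; lia.
  exact: si1.
(* No triangle follows the last one, so the hypothesis on {n-1, n} excludes the swap there. *)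
move=> a b ab; have [bn|bn] := leqP b n.-1; first by apply: (H n.-2) => //; lia.
have {bn} bE : b = n by move: ab; rewrite /edge; lia.
subst b.
have [->|->] : a = n.-2 \/ a = n.-1 by move: ab; rewrite /edge; lia.
  have e1 : n.-2.+1 = n.-1 by lia.
  have e2 : n.-1.+1 = n by lia.
  have := @fixed_nbrs_step y n.-2; rewrite e1 e2; apply=> // a' b' ab' bn.
  by apply: (H n.-2) => //; lia.
exact: sn.
Qed.

(** The vertex is a common neighbour of the fixed vertices [x + w p q] and [x + w 0 1], and so is
    its image. *)
Lemma fixed_start_at_nbr x p q : (3 < n)%N -> s x = x ->
    (forall a b, edge n a b -> s (x + w a b) = x + w a b) ->
  edge n p q -> s (x + w p q + w 0 1) = x + w p q + w 0 1.
Proof.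
move=> n3 sx sN pq.
have e01 : edge n 0 1 by rewrite /edge; lia.
have e12 : edge n 1 2 by rewrite /edge; lia.
have e34 : edge n 3 4 by rewrite /edge; lia.
(* An edge [c e] with [w 0 1 + w p q + w c e] again an edge closes a 4-cycle in
   the square of the path; the only one through the edge [0 1] is 0-1-3-2. *)
have step u v : edge n u v -> u != 0%N ->
    s (x + w u v + w 0 1) = x + w u v + w 0 1 \/
    s (x + w u v + w 0 1) = x + w u v + w 0 2 /\
      (u = 1%N /\ v = 3%N \/ u = 2%N /\ v = 3%N).
  move=> uv u0.
  have [c [e [ce E]]] := image_edge (sN _ _ uv) e01.
  have : AQ (x + w 0 1) (x + w u v + w c e).
    rewrite -E -(sN _ _ e01) s_aut addrAC; exact: adj_edge.
  case/(frame_adj F) => k [m [km E2]].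
  have E3 : w c e = w 0 1 + w u v + w k m.
    apply: (addrI (x + w u v)); rewrite E2; row_char2.
  (* Parity at the point 0, which lies on {0, 1} but not on {u, v}. *)
  have c0k : (c == 0%N) != (k == 0%N).
    have := congr1 (d 0) E3; rewrite (frameD F _ (w 0 1 + w u v)).
    rewrite (frameD F _ (w 0 1)) !frame_edge //.
    move: uv ce km u0; rewrite /edge eq_sym; case: c {E E2 E3} => [|c];
    case: k => [|k]; case: u => [|u]; case: v => [|v]; case: e => [|e];
    by case: m => [|m].
  have [c0|c0] := eqVneq c 0%N.
    subst c.
    have [e1|e1] := eqVneq e 1%N; first by left; rewrite E e1.
    have e2 : e = 2%N by move: ce; rewrite /edge; lia.
    subst e; right; split=> //.
    have : AQ (x + w 1 2) (x + w u v).
      apply/(frame_adj F); exists k, m; split=> //.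
      have -> : w k m = w 0 1 + w u v + w 0 2 by rewrite E3; row_char2.
      row_char2.
    by rewrite adj_edges //; move: uv u0; rewrite /edge; lia.
  have k0 : k = 0%N by move: c0k; rewrite (negPf c0); case: (eqVneq k).
  (* The image is [x + w 0 1 + w 0 m] with m = 1 or 2, that is, [x] or [x + w 1 2]. *)
  subst k; left; apply: fixed_of_fixed_image; rewrite E E3.
  have [m1|m1] := eqVneq m 1%N.
    by subst m; have -> : x + w u v + (w 0 1 + w u v + w 0 1) = x by row_char2.
  have m2 : m = 2%N by move: km; rewrite /edge; lia.
  subst m.
  have -> : x + w u v + (w 0 1 + w u v + w 0 2) = x + w 1 2 by row_char2.
  exact: sN.
have [p0|p0] := eqVneq p 0%N.
  subst p; have [q1|q1] := eqVneq q 1%N.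
    by subst q; have -> : x + w 0 1 + w 0 1 = x by row_char2.
  have q2 : q = 2%N by move: pq; rewrite /edge; lia.
  subst q; have -> : x + w 0 2 + w 0 1 = x + w 1 2 by row_char2.
  exact: sN.
have [//|[E pqE]] := step p q pq p0.
(* In the remaining cases the fixed vertex [x + w 3 4 + w 0 1] is adjacent to
   exactly one of the two candidates. *)
have s34 : s (x + w 3 4 + w 0 1) = x + w 3 4 + w 0 1.
  by have [//|[_ []]] := step 3 4 e34 isT; case.
have := s_aut (x + w p q + w 0 1) (x + w 3 4 + w 0 1); rewrite s34 E.
case: pqE => -[-> ->].
  have -> : x + w 3 4 + w 0 1 = x + w 1 3 + w 0 2 + w 2 4 by row_char2.
  have {2}-> : x + w 1 3 + w 0 2 + w 2 4 = x + w 1 3 + w 0 1 + w 1 4 by row_char2.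
  by rewrite !adj_pair //; lia.
have -> : x + w 3 4 + w 0 1 = x + w 2 3 + w 0 2 + w 1 4 by row_char2.
have {2}-> : x + w 2 3 + w 0 2 + w 1 4 = x + w 2 3 + w 0 1 + w 2 4 by row_char2.
by rewrite !adj_pair //; lia.
Qed.

End Frame.

(** Transfers results about the end {0, 1} to the end {n-1, n}. *)
Lemma rev_frame n (g : nat -> 'rV['Z_2]_n) d : path_frame g d ->
  path_frame (fun a => g (n - a)%N) (fun z => d (n - z)%N).
Proof.
move=> F; split=> [z u v|a b z an bn zn|u v]; first exact: (frameD F).
  by rewrite (frame_pair F) ?leq_subr //; congr (_ (+) _); lia.
rewrite (frame_adj F); split=> -[a [b [ab ->]]]; exists (n - b)%N, (n - a)%N.
  split; first by move: ab; rewrite /edge; lia.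
  by rewrite !subKn 1?[g b + _]addrC //; move: ab; rewrite /edge; lia.
split; first by move: ab; rewrite /edge; lia.
by rewrite [g (n - b)%N + _]addrC.
Qed.

(** * Path coordinates for the augmented hypercube *)

(* The [k]-th bit is the coordinate at position [k.-1]; it is 0 for [k = 0] and
   constant from [k = n] on, so that the second difference [pt] needs no
   special case at the two ends of the path. *)
Definition bit n (v : 'rV['Z_2]_n) (k : nat) : bool :=
  [exists i : 'I_n, (i.+1 == minn k n) && (v ord0 i != 0)].

Definition pt n (z : nat) (v : 'rV['Z_2]_n) : bool := bit v z.+1 (+) bit v z.-1.

(** This is the sum of the suffix vectors starting at positions 0, ..., a-1. *)
Definition gen n (a : nat) : 'rV['Z_2]_n := \row_j (minn a j.+1)%:R.

Lemma natZ2_neq0 k : (k%:R != 0 :> 'Z_2) = odd k.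
Proof. by rewrite -val_eqE /= val_Zp_nat // modn2; case: (odd k). Qed.

Lemma addZ2_neq0 (a b : 'Z_2) : (a + b != 0) = (a != 0) (+) (b != 0).
Proof. by case: a b => [[|[|[]]]] //= ? [[|[|[]]]]. Qed.

Lemma addZ2_neq (a b : 'Z_2) : (a != a + b) = (b != 0).
Proof. by case: a b => [[|[|[]]]] //= ? [[|[|[]]]]. Qed.

Lemma Z2_eq_neq0 (a b : 'Z_2) : (a != 0) = (b != 0) -> a = b.
Proof. by case: a b => [[|[|[]]]] //= ? [[|[|[]]]] //= ? _; apply/val_inj. Qed.

Lemma bitP n (v : 'rV['Z_2]_n) k (i : 'I_n) : i.+1 = minn k n ->
  bit v k = (v ord0 i != 0).
Proof.
move=> ik; apply/existsP/idP => [[j /andP[/eqP jk]]|vi]; last first.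
  by exists i; rewrite ik eqxx.
by suff -> : j = i by []; apply/val_inj/succn_inj; rewrite jk.
Qed.

Lemma bit_false n (v : 'rV['Z_2]_n) k : minn k n = 0%N -> bit v k = false.
Proof. by move=> k0; apply/existsP => -[i]; rewrite k0. Qed.

Lemma minn_ord k n : minn k n = 0%N \/ exists i : 'I_n, i.+1 = minn k n.
Proof.
case E: (minn k n) => [|m]; [by left|right].
by have mn : (m < n)%N by [lia]; exists (Ordinal mn).
Qed.

Lemma bitD n (u v : 'rV['Z_2]_n) k : bit (u + v) k = bit u k (+) bit v k.
Proof.
have [k0|[i ik]] := minn_ord k n; first by rewrite !bit_false.
by rewrite !(bitP _ ik) mxE addZ2_neq0.
Qed.

Lemma bit_gen n a k : bit (gen n a) k = odd (minn a (minn k n)).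
Proof.
have [k0|[i ik]] := minn_ord k n; first by rewrite bit_false // k0 minn0.
by rewrite (bitP _ ik) mxE natZ2_neq0 ik.
Qed.

(** The slope of k -> min(a, k) drops from 1 to 0 at a, so its change from z-1 to z+1 is odd only at
    z = a. At z = 0 the truncated predecessor adds a term that cancels in pairs. *)
Lemma pt_gen n a z : (a <= n)%N -> (z <= n)%N ->
  pt z (gen n a) = (z == a) (+) (z == 0%N).
Proof.
move=> an zn; rewrite /pt !bit_gen.
have -> : minn a (minn z.+1 n) = minn a z.+1 by lia.
have -> : minn a (minn z.-1 n) = minn a z.-1 by lia.
case: z zn => [|z] zn; first by case: a an.
rewrite /= addbF; have [az|za|za] := ltngtP z.+1 a.
- have -> : minn a z.+2 = z.+2 by lia.
  have -> : minn a z = z by lia.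
  by rewrite /= negbK addbb.
- have -> : minn a z.+2 = a by lia.
  have -> : minn a z = a by lia.
  by rewrite addbb.
by subst a; rewrite (minn_idPl (leqnSn _)) (minn_idPr (leqnSn _)) /= addNb addbb.
Qed.

Lemma row_diffP n (u v x : 'rV['Z_2]_n) :
  v = u + x <-> forall j, (u ord0 j != v ord0 j) = (x ord0 j != 0).
Proof.
split=> [-> j|h]; first by rewrite mxE addZ2_neq.
apply/rowP => j; rewrite mxE; apply: (addrI (- u ord0 j)); rewrite addKr.
by apply: Z2_eq_neq0; rewrite -h addrC subr_eq0 eq_sym.
Qed.

Lemma gen_suffix n a (j : 'I_n) :
  ((gen n a + gen n a.+1) ord0 j != 0) = (a <= j)%N.
Proof.
rewrite !mxE addZ2_neq0 !natZ2_neq0; have [aj|ja] := leqP a j.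
  have -> : minn a j.+1 = a by lia.
  have -> : minn a.+1 j.+1 = a.+1 by lia.
  by rewrite /= addbN addbb.
have -> : minn a j.+1 = j.+1 by lia.
have -> : minn a.+1 j.+1 = j.+1 by lia.
by rewrite addbb.
Qed.

Lemma gen_unit n a (j : 'I_n) :
  ((gen n a + gen n a.+2) ord0 j != 0) = (j == a :> nat).
Proof.
have -> : gen n a + gen n a.+2 =
    (gen n a + gen n a.+1) + (gen n a.+1 + gen n a.+2).
  by row_char2.
by rewrite mxE addZ2_neq0 !gen_suffix; case: (ltngtP j a).
Qed.

Lemma AQ_unit n (u v : 'rV['Z_2]_n) (i : 'I_n) :
  (forall j, (u ord0 j != v ord0 j) = (j == i)) -> AQ u v.
Proof.
move=> h; apply/orP; left; rewrite (_ : [set _ | _] = [set i]) ?cards1 //.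
by apply/setP => j; rewrite !inE h.
Qed.

Lemma gen_frame n : path_frame (gen n) (@pt n).
Proof.
split=> [z u v|a b z an bn zn|u v].
- by rewrite /pt !bitD addbACA.
- rewrite -[LHS]/(bit _ _ (+) bit _ _) !bitD addbACA -/(pt _ _) -/(pt _ _).
  by rewrite !pt_gen // addbACA addbb addbF.
split.
  case/orP => [/cards1P[i /setP iP]|/existsP[l /forallP lP]].
    have {}iP j : (u ord0 j != v ord0 j) = (j == i) by have := iP j; rewrite !inE.
    (* Flipping position i is the pair {i, i+2}, except that the last position gives the suffix
       {n-1, n}. *)
    have [iN|iN] := leqP i.+2 n.
      exists i, i.+2; split; first by rewrite /edge; lia.
      by apply/row_diffP => j; rewrite iP gen_unit.
    have iE := ltn_ord i; exists i, i.+1; split; first by rewrite /edge; lia.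
    apply/row_diffP => j; rewrite iP gen_suffix -val_eqE /=.
    by have := ltn_ord j; lia.
  have ln := ltn_ord l; exists l, l.+1; split; first by rewrite /edge; lia.
  apply/row_diffP => j; rewrite gen_suffix.
  by have := lP j; case: ltnP => [_ /eqP->|_ ->]; rewrite ?eqxx.
move=> [a [b [/and3P[ab ba bn] /row_diffP h]]].
have [b2|b2] := eqVneq b a.+2.
  subst b; have an : (a < n)%N by lia.
  by apply: (@AQ_unit _ _ _ (Ordinal an)) => j; rewrite h gen_unit.
have b1 : b = a.+1 by lia.
(* The suffix of length one is not among the l <= n-2; it counts as a single flip. *)
subst b; have [an|an] := ltnP a n.-1.
  apply/orP; right; apply/existsP; exists (Ordinal an); apply/forallP => j /=.
  by have := h j; rewrite gen_suffix; case: ltnP => _ => [/negbFE|].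
apply: (@AQ_unit _ _ _ (Ordinal bn)) => j; rewrite h gen_suffix -val_eqE /=.
by have := ltn_ord j; lia.
Qed.

(** Connectedness: every row is a sum of unit vectors, and adding one is a step along an edge. *)
Lemma AQ_ind n (P : 'rV['Z_2]_n -> Prop) :
  P 0 -> (forall u v, AQ u v -> P u -> P v) -> forall v, P v.
Proof.
move=> P0 PS v; rewrite [v]row_sum_delta; apply: big_rec => // j x _.
move=> Px; have [->|vj] := eqVneq (v ord0 j) 0; first by rewrite scale0r add0r.
apply: PS Px; apply: (@AQ_unit _ _ _ j) => k.
rewrite addrC mxE addZ2_neq !mxE /= mulr_natr.
by have [_|_] := eqVneq k j; rewrite ?mulr1n ?mulr0n ?eqxx.
Qed.

(* The determining set *)
Local Close Scope ring_scope.

Theorem theorem7p2 (n : nat) (hn : 4 <= n) : det_number (@AQ n) <= 3.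
Proof.
pose g := gen n; have F := gen_frame n; have F' := rev_frame F.
pose S : {set 'rV['Z_2]_n} := [set:: [:: 0; g 0 + g 1; g n.-1 + g n]%R].
suff dS : determining (@AQ n) S.
  apply: leq_trans ((det_numberP _).2 S dS) _.
  by rewrite cardsE (leq_trans (card_size _)).
apply/forallP => s; apply/implyP => /forallP s_aut'.
apply/implyP => /forallP sS'.
have s_aut u v : AQ (s u) (s v) = AQ u v by have /forallP/(_ v)/eqP := s_aut' u.
have sS v : v \in S -> s v = v by move=> vS; have := sS' v; rewrite vS => /eqP.
pose Q v := s v = v /\ forall a b, edge n a b -> 
  s (v + (g a + g b))%R = (v + (g a + g b))%R.
suff QT v : Q v by apply/eqP/permP => v; rewrite perm1; case: (QT v).
apply: AQ_ind v => [|u v /(frame_adj F)[p [q [pq ->]]] [su sN]].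
  have s0 : s 0%R = 0%R by apply: sS; rewrite !inE eqxx.
  split=> //; apply: (fixed_nbrs F s_aut) => //; first by lia.
    by rewrite add0r; apply: sS; rewrite !inE eqxx orbT.
  by rewrite add0r; apply: sS; rewrite !inE eqxx !orbT.
split; first exact: sN.
apply: (fixed_nbrs F s_aut); first by lia.
- exact: sN.
- exact: (fixed_start_at_nbr F s_aut).
(* In the reversed frame {p, q} becomes {n-q, n-p}, and the starting edge is {n-1, n}. *)
have := @fixed_start_at_nbr _ _ _ F' s s_aut u (n - q) (n - p) hn su.
have [pn qn] : (p <= n) /\ (q <= n) by move: pq; rewrite /edge; lia.
rewrite !subKn // subn0 subn1 [(g q + _)%R]addrC [(g n + _)%R]addrC; apply.
  move=> a b ab; rewrite [(g (n - a)%N + _)%R]addrC; apply: sN.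
  by move: ab; rewrite /edge; lia.
by move: pq; rewrite /edge; lia.
Qed.
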